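(* Let $\mathsf{B}$ be a locally abelian bicategory whose left and right multiplications are right exact functors. Let $\Gamma=(f,g,\eta,\rho)$ be a wide right Morita context from $B$ to $A$ in $\mathsf{B}$. If $\eta$ and $\rho$ are epimorphisms, then they are isomorphisms. In particular, if $\eta$ and $\rho$ are epimorphisms, then $A$ and $B$ are equivalent inside $\mathsf{B}$.
   Context: Conventions for bicategories. A bicategory $\mathsf{B}$ has a class of $0$-cells; for each pair of $0$-cells $A,B$ a category ${}_A\mathsf{B}_B$, whose objects are the $1$-cells from $B$ to $A$ and whose morphisms are the $2$-cells (composition in this category is written $\circ$); multiplication functors ${}_A\mathsf{B}_B\times{}_B\mathsf{B}_C\to{}_A\mathsf{B}_C$, $(f,g)\mapsto fg$ on $1$-cells and $(\alpha,\beta)\mapsto\alpha\beta$ on $2$-cells; identity $1$-cells $\mathbb{I}_A\in{}_A\mathsf{B}_A$; and natural isomorphisms $\mathfrak{a}_{f,g,h}:(fg)h\to f(gh)$, $\mathfrak{r}_f:f\mathbb{I}_B\to f$, $\mathfrak{l}_f:\mathbb{I}_Af\to f$ satisfying the usual pentagon and triangle axioms. $1_f$ denotes the identity $2$-cell of $f$. Locally abelian means that every category ${}_A\mathsf{B}_B$ is abelian. Left and right multiplications are the functors $h-$ and $-h$ between hom-categories given by multiplying with a fixed $1$-cell $h$ on the left or on the right. Wide right Morita context. A wide right Morita context from $B$ to $A$ is a four-tuple $(f,g,\eta,\rho)$ with $f\in{}_A\mathsf{B}_B$, $g\in{}_B\mathsf{B}_A$ and $2$-cells $\eta:fg\to\mathbb{I}_A$,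 $\rho:gf\to\mathbb{I}_B$ such that $$\mathfrak{r}_g\circ(1_g\,\eta)\circ\mathfrak{a}_{g,f,g}=\mathfrak{l}_g\circ(\rho\,1_g),\qquad \mathfrak{l}_f\circ(\eta\,1_f)=\mathfrak{r}_f\circ(1_f\,\rho)\circ\mathfrak{a}_{f,g,f}.$$ Equivalence. $A$ is equivalent to $B$ inside $\mathsf{B}$ if there are $1$-cells $f\in{}_A\mathsf{B}_B$, $g\in{}_B\mathsf{B}_A$ and isomorphisms $fg\to\mathbb{I}_A$ in ${}_A\mathsf{B}_A$ and $\mathbb{I}_B\to gf$ in ${}_B\mathsf{B}_B$. *)

(* Defs.v *)
Set Implicit Arguments.
Unset Strict Implicit.
Unset Printing Implicit Defensive.

Declare Scope cat_scope.
Delimit Scope cat_scope with cat.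
Local Open Scope cat_scope.

Reserved Notation "b ∘ a" (at level 40, left associativity).
Reserved Notation "f ⋅ g" (at level 38, left associativity).
Reserved Notation "α ⋆ β" (at level 38, left associativity).

(** * Categories and functors *)

Record category := Category {
  obj :> Type;
  mor : obj -> obj -> Type;
  idm : forall x : obj, mor x x;
  comp : forall x y z : obj, mor y z -> mor x y -> mor x z;
  comp_idl : forall (x y : obj) (a : mor x y), comp (idm y) a = a;
  comp_idr : forall (x y : obj) (a : mor x y), comp a (idm x) = a;
  comp_assoc : forall (x y z t : obj) (c : mor z t) (b : mor y z) (a : mor x y),
    comp c (comp b a) = comp (comp c b) a
}.

Arguments mor {c} x y : rename.
Arguments idm {c} x : rename.
Arguments comp {c x y z} b a : rename.

Notation "b ∘ a" := (comp b a) : cat_scope.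

Section Morphisms.
Variable C : category.

Definition is_iso (x y : C) (a : mor x y) : Prop :=
  exists b : mor y x, b ∘ a = idm x /\ a ∘ b = idm y.

Definition is_mono (x y : C) (a : mor x y) : Prop :=
  forall (t : C) (u v : mor t x), a ∘ u = a ∘ v -> u = v.

Definition is_epi (x y : C) (a : mor x y) : Prop :=
  forall (t : C) (u v : mor y t), u ∘ a = v ∘ a -> u = v.

Definition is_zero_object (z : C) : Prop :=
  (forall x : C, exists a : mor x z, forall b : mor x z, b = a) /\
  (forall x : C, exists a : mor z x, forall b : mor z x, b = a).

End Morphisms.

Record functor (C D : category) := Functor {
  fobj :> C -> D;
  fmap : forall x y : C, mor x y -> mor (fobj x) (fobj y);
  fmap_id : forall x : C, fmap (idm x) = idm (fobj x);
  fmap_comp : forall (x y z : C) (b : mor y z) (a : mor x y),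
    fmap (b ∘ a) = fmap b ∘ fmap a
}.

Arguments fmap {C D} F {x y} a : rename.

Definition prod_category (C D : category) : category.
Proof.
refine (@Category (C * D)%type
  (fun x y => (mor (fst x) (fst y) * mor (snd x) (snd y))%type)
  (fun x => (idm (fst x), idm (snd x)))
  (fun x y z b a => (fst b ∘ fst a, snd b ∘ snd a)) _ _ _).
- intros x y [a1 a2]; cbn; now rewrite !comp_idl.
- intros x y [a1 a2]; cbn; now rewrite !comp_idr.
- intros x y z t c b a; cbn; now rewrite !comp_assoc.
Defined.

(** * Abelian categories *)

Record preadditive (C : category) := Preadditive {
  zerom : forall x y : C, mor x y;
  addm : forall x y : C, mor x y -> mor x y -> mor x y;
  oppm : forall x y : C, mor x y -> mor x y;
  addm_assoc : forall (x y : C) (a b c : mor x y),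
    addm a (addm b c) = addm (addm a b) c;
  addm_comm : forall (x y : C) (a b : mor x y), addm a b = addm b a;
  addm_zero : forall (x y : C) (a : mor x y), addm (zerom x y) a = a;
  addm_opp : forall (x y : C) (a : mor x y), addm (oppm a) a = zerom x y;
  comp_addl : forall (x y z : C) (b b' : mor y z) (a : mor x y),
    addm b b' ∘ a = addm (b ∘ a) (b' ∘ a);
  comp_addr : forall (x y z : C) (b : mor y z) (a a' : mor x y),
    b ∘ addm a a' = addm (b ∘ a) (b ∘ a')
}.

Arguments zerom {C} P x y : rename.
Arguments addm {C} P {x y} a b : rename.
Arguments oppm {C} P {x y} a : rename.

Section Preadditive.
Variables (C : category) (P : preadditive C).

Definition is_kernel (k x y : C) (a : mor x y) (i : mor k x) : Prop :=
  a ∘ i = zerom P k y /\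
  forall (t : C) (u : mor t x), a ∘ u = zerom P t y ->
    exists v : mor t k, i ∘ v = u /\ forall w : mor t k, i ∘ w = u -> w = v.

Definition is_cokernel (x y q : C) (a : mor x y) (p : mor y q) : Prop :=
  p ∘ a = zerom P x q /\
  forall (t : C) (u : mor y t), u ∘ a = zerom P x t ->
    exists v : mor q t, v ∘ p = u /\ forall w : mor q t, w ∘ p = u -> w = v.

Definition is_biproduct (x y s : C) (i : mor x s) (j : mor y s)
    (p : mor s x) (q : mor s y) : Prop :=
  p ∘ i = idm x /\ q ∘ j = idm y /\ addm P (i ∘ p) (j ∘ q) = idm s.

(* The image of [a] is the kernel of its cokernel; exactness at [y] says that
   the image of [a] and the kernel of [b] are the same subobject [m] of [y]. *)
Definition is_exact (x y z : C) (a : mor x y) (b : mor y z) : Prop :=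
  exists (q : C) (p : mor y q) (k : C) (m : mor k y),
    is_cokernel a p /\ is_kernel p m /\ is_kernel b m.

Definition is_short_exact (x y z : C) (a : mor x y) (b : mor y z) : Prop :=
  is_mono a /\ is_exact a b /\ is_epi b.

End Preadditive.

Record abelian (C : category) := Abelian {
  abelian_add :> preadditive C;
  abelian_zero : exists z : C, is_zero_object z;
  abelian_biproduct : forall x y : C,
    exists (s : C) (i : mor x s) (j : mor y s) (p : mor s x) (q : mor s y),
      is_biproduct abelian_add i j p q;
  abelian_kernel : forall (x y : C) (a : mor x y),
    exists (k : C) (i : mor k x), is_kernel abelian_add a i;
  abelian_cokernel : forall (x y : C) (a : mor x y),
    exists (q : C) (p : mor y q), is_cokernel abelian_add a p;
  abelian_mono : forall (x y : C) (a : mor x y), is_mono a ->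
    exists (z : C) (b : mor y z), is_kernel abelian_add b a;
  abelian_epi : forall (x y : C) (a : mor x y), is_epi a ->
    exists (z : C) (b : mor z x), is_cokernel abelian_add b a
}.

Definition is_additive (C D : category) (P : preadditive C) (Q : preadditive D)
    (F : functor C D) : Prop :=
  forall (x y : C) (a b : mor x y),
    fmap F (addm P a b) = addm Q (fmap F a) (fmap F b).

Definition is_right_exact (C D : category) (P : abelian C) (Q : abelian D)
    (F : functor C D) : Prop :=
  is_additive P Q F /\
  forall (x y z : C) (a : mor x y) (b : mor y z), is_short_exact P a b ->
    is_exact Q (fmap F a) (fmap F b) /\ is_epi (fmap F b).

(** * Bicategories *)

Section MultiplicationNotations.
Variables (ob : Type) (hom : ob -> ob -> category)
  (mult : forall A B C : ob,
     functor (prod_category (hom A B) (hom B C)) (hom A C)).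

Definition mul1 (A B C : ob) (f : hom A B) (g : hom B C) : hom A C :=
  mult A B C (f, g).

Definition mul2 (A B C : ob) (f f' : hom A B) (g g' : hom B C)
    (α : mor f f') (β : mor g g') : mor (mul1 f g) (mul1 f' g') :=
  @fmap _ _ (mult A B C) (f, g) (f', g') (α, β).

End MultiplicationNotations.

(* [hom A B] is the category of 1-cells from [B] to [A]. *)
Record bicategory := Bicategory {
  cell0 :> Type;
  hom : cell0 -> cell0 -> category;
  mult : forall A B C : cell0,
    functor (prod_category (hom A B) (hom B C)) (hom A C);
  unit1 : forall A : cell0, hom A A;
  assoc : forall (A B C D : cell0) (f : hom A B) (g : hom B C) (h : hom C D),
    mor (mul1 mult (mul1 mult f g) h) (mul1 mult f (mul1 mult g h));
  runit : forall (A B : cell0) (f : hom A B), mor (mul1 mult f (unit1 B)) f;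
  lunit : forall (A B : cell0) (f : hom A B), mor (mul1 mult (unit1 A) f) f;
  assoc_iso : forall (A B C D : cell0)
    (f : hom A B) (g : hom B C) (h : hom C D), is_iso (assoc f g h);
  runit_iso : forall (A B : cell0) (f : hom A B), is_iso (runit f);
  lunit_iso : forall (A B : cell0) (f : hom A B), is_iso (lunit f);
  assoc_natural : forall (A B C D : cell0)
    (f f' : hom A B) (g g' : hom B C) (h h' : hom C D)
    (α : mor f f') (β : mor g g') (γ : mor h h'),
    assoc f' g' h' ∘ mul2 mult (mul2 mult α β) γ
    = mul2 mult α (mul2 mult β γ) ∘ assoc f g h;
  runit_natural : forall (A B : cell0) (f f' : hom A B) (α : mor f f'),
    runit f' ∘ mul2 mult α (idm (unit1 B)) = α ∘ runit f;
  lunit_natural : forall (A B : cell0) (f f' : hom A B) (α : mor f f'),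
    lunit f' ∘ mul2 mult (idm (unit1 A)) α = α ∘ lunit f;
  pentagon : forall (A B C D E : cell0)
    (f : hom A B) (g : hom B C) (h : hom C D) (k : hom D E),
    assoc f g (mul1 mult h k) ∘ assoc (mul1 mult f g) h k
    = mul2 mult (idm f) (assoc g h k) ∘ assoc f (mul1 mult g h) k
      ∘ mul2 mult (assoc f g h) (idm k);
  triangle : forall (A B C : cell0) (f : hom A B) (g : hom B C),
    mul2 mult (idm f) (lunit g) ∘ assoc f (unit1 B) g
    = mul2 mult (runit f) (idm g)
}.

Arguments hom {b} A B : rename.
Arguments mult {b} A B C : rename.
Arguments unit1 {b} A : rename.
Arguments assoc {b A B C D} f g h : rename.
Arguments runit {b A B} f : rename.
Arguments lunit {b A B} f : rename.

Notation "f ⋅ g" := (mul1 mult f g) : cat_scope.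
Notation "α ⋆ β" := (mul2 mult α β) : cat_scope.

Section Bicategory.
Variable BB : bicategory.

Definition left_mult (A B C : BB) (h : hom A B) : functor (hom B C) (hom A C).
Proof.
refine (@Functor (hom B C) (hom A C) (fun f => h ⋅ f)
  (fun f f' α => idm h ⋆ α) _ _).
- intros f; exact (fmap_id (mult A B C) (h, f)).
- intros f f' f'' β α.
  transitivity ((idm h ∘ idm h) ⋆ (β ∘ α)); [now rewrite comp_idl|].
  exact (@fmap_comp _ _ (mult A B C) (h, f) (h, f') (h, f'')
           (idm h, β) (idm h, α)).
Defined.

Definition right_mult (A B C : BB) (h : hom B C) : functor (hom A B) (hom A C).
Proof.
refine (@Functor (hom A B) (hom A C) (fun f => f ⋅ h)
  (fun f f' α => α ⋆ idm h) _ _).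
- intros f; exact (fmap_id (mult A B C) (f, h)).
- intros f f' f'' β α.
  transitivity ((β ∘ α) ⋆ (idm h ∘ idm h)); [now rewrite comp_idl|].
  exact (@fmap_comp _ _ (mult A B C) (f, h) (f', h) (f'', h)
           (β, idm h) (α, idm h)).
Defined.

Definition locally_abelian : Type := forall A B : BB, abelian (hom A B).

Definition right_exact_multiplications (ab : locally_abelian) : Prop :=
  (forall (A B C : BB) (h : hom A B),
     is_right_exact (ab B C) (ab A C) (left_mult C h)) /\
  (forall (A B C : BB) (h : hom B C),
     is_right_exact (ab A B) (ab A C) (right_mult A h)).

(* A context from [B] to [A]. *)
Record wide_right_Morita_context (A B : BB) := WideRightMoritaContext {
  mc_f : hom A B;
  mc_g : hom B A;
  mc_eta : mor (mc_f ⋅ mc_g) (unit1 A);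
  mc_rho : mor (mc_g ⋅ mc_f) (unit1 B);
  mc_compat_g :
    runit mc_g ∘ (idm mc_g ⋆ mc_eta) ∘ assoc mc_g mc_f mc_g
    = lunit mc_g ∘ (mc_rho ⋆ idm mc_g);
  mc_compat_f :
    lunit mc_f ∘ (mc_eta ⋆ idm mc_f)
    = runit mc_f ∘ (idm mc_f ⋆ mc_rho) ∘ assoc mc_f mc_g mc_f
}.

Definition equivalent (A B : BB) : Prop :=
  exists (f : hom A B) (g : hom B A)
         (φ : mor (f ⋅ g) (unit1 A)) (ψ : mor (unit1 B) (g ⋅ f)),
    is_iso φ /\ is_iso ψ.

End Bicategory.

(* Main.v *)
(** In ring-theoretic notation: if [Σ η(a_j, b_j) = 1] and [η(x, y) = 0], then
    [x ⊗ y = Σ x ⊗ y η(a_j, b_j) = Σ x ⊗ ρ(y, a_j) b_j = Σ x ρ(y, a_j) ⊗ b_j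
    = Σ η(x, y) a_j ⊗ b_j = 0].  In a bicategory the middle steps become
    [𝔯 ∘ (1 ⋆ η) = 𝔩 ∘ (η ⋆ 1)] on [(f⋅g)⋅(f⋅g)], which is where the coherence
    axioms are used.  Hence a 2-cell [u : k -> f⋅g] killed by [η] satisfies
    [u ∘ (𝔯 ∘ (1_k ⋆ η)) = 𝔩 ∘ ((η ∘ u) ⋆ 1) = 0], and [𝔯 ∘ (1_k ⋆ η)] is epi by
    right exactness, so [u = 0]: the epimorphism [η] is also mono. *)

Require Import Defs.
From Stdlib Require Import ssreflect.

Set Implicit Arguments.
Unset Strict Implicit.
Unset Printing Implicit Defensive.
Local Open Scope cat_scope.

Section Category.
Variable C : category.

Lemma iso_epi (x y : C) (a : mor x y) : is_iso a -> is_epi a.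
Proof.
move=> [b [_ ab]] t u v e.
by rewrite -(comp_idr u) -(comp_idr v) -ab !comp_assoc e.
Qed.

Lemma iso_mono (x y : C) (a : mor x y) : is_iso a -> is_mono a.
Proof.
move=> [b [ba _]] t u v e.
by rewrite -(comp_idl u) -(comp_idl v) -ba -!comp_assoc e.
Qed.

Lemma epi_comp (x y z : C) (b : mor y z) (a : mor x y) :
  is_epi b -> is_epi a -> is_epi (b ∘ a).
Proof. by move=> eb ea t u v; rewrite !comp_assoc => /ea /eb. Qed.

End Category.

Lemma fmap_iso (C D : category) (F : functor C D) (x y : C) (a : mor x y) :
  is_iso a -> is_iso (fmap F a).
Proof.
by move=> [b [ba ab]]; exists (fmap F b); rewrite -!fmap_comp ba ab !fmap_id.
Qed.

Section Additive.
Variables (C : category) (P : preadditive C).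

Lemma addm_cancel (x y : C) (a b c : mor x y) :
  addm P a b = addm P a c -> b = c.
Proof.
move=> e; rewrite -(addm_zero P b) -(addm_zero P c) -(addm_opp P a).
by rewrite -!addm_assoc e.
Qed.

Lemma addm_zeror (x y : C) (a : mor x y) : addm P a (zerom P x y) = a.
Proof. by rewrite addm_comm addm_zero. Qed.

Lemma comp_zerol (x y z : C) (a : mor x y) : zerom P y z ∘ a = zerom P x z.
Proof.
apply: (@addm_cancel _ _ (zerom P y z ∘ a)).
by rewrite -comp_addl addm_zero addm_zeror.
Qed.

Lemma comp_zeror (x y z : C) (b : mor y z) : b ∘ zerom P x y = zerom P x z.
Proof.
apply: (@addm_cancel _ _ (b ∘ zerom P x y)).
by rewrite -comp_addr addm_zero addm_zeror.
Qed.

Lemma mono_of_zero (x y : C) (a : mor x y) :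
  (forall (t : C) (u : mor t x), a ∘ u = zerom P t y -> u = zerom P t x) ->
  is_mono a.
Proof.
move=> ha t u v e; apply: (@addm_cancel _ _ (oppm P v)).
rewrite addm_opp; apply: ha.
by rewrite comp_addr e -comp_addr addm_opp comp_zeror.
Qed.

Lemma kernel_mono (k x y : C) (a : mor x y) (i : mor k x) :
  is_kernel P a i -> is_mono i.
Proof.
move=> [ai ker] t u v e.
have [|w [_ uniq]] := ker t (i ∘ v); first by rewrite comp_assoc ai comp_zerol.
by rewrite (uniq _ e) -(uniq v).
Qed.

End Additive.

Lemma additive_zero (C D : category) (P : preadditive C) (Q : preadditive D)
    (F : functor C D) (x y : C) :
  is_additive P Q F -> fmap F (zerom P x y) = zerom Q _ _.
Proof.
move=> addF; apply: (@addm_cancel _ Q _ _ (fmap F (zerom P x y))).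
by rewrite -addF addm_zero addm_zeror.
Qed.

Section Abelian.
Variables (C : category) (P : abelian C).

(** [a] is the cokernel of some [c]. As [a] is mono, [a ∘ c = 0] forces [c = 0], so [idm x] factors
    through [a]; the factor is also a right inverse because [a] is epi. *)
Lemma mono_epi_iso (x y : C) (a : mor x y) :
  is_mono a -> is_epi a -> is_iso a.
Proof.
move=> ma ea; have [z [c [ac coker]]] := abelian_epi P ea.
have c0 : c = zerom P z x by apply: ma; rewrite ac comp_zeror.
have [|v [va _]] := coker _ (idm x); first by rewrite comp_idl.
exists v; split=> //; apply: ea.
by rewrite -comp_assoc va comp_idr comp_idl.
Qed.

(** [a] is the cokernel of some [c], which factors through the kernel [i]; so whatever kills [i]
    kills [c] and factors through [a]. *)
Lemma epi_cokernel_of_kernel (x y k : C) (a : mor x y) (i : mor k x) :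
  is_epi a -> is_kernel P a i -> is_cokernel P i a.
Proof.
move=> ea [ai ker]; split=> // t u ui.
have [z [c [ac coker]]] := abelian_epi P ea.
have [c' [ic' _]] := ker _ _ ac; apply: coker.
by rewrite -ic' comp_assoc ui comp_zerol.
Qed.

Lemma epi_short_exact (x y : C) (a : mor x y) :
  is_epi a -> exists (k : C) (i : mor k x), is_short_exact P i a.
Proof.
move=> ea; have [k [i ki]] := abelian_kernel P a.
exists k, i; split; first exact: kernel_mono ki.
(* The cokernel of [i] is [a] itself, so [i] serves as both kernels. *)
split=> //; exists y, a, k, i.
by split; first exact: epi_cokernel_of_kernel.
Qed.

End Abelian.

(** Right exactness speaks of short exact sequences, so [a] is first completed to one by its
    kernel. *)
Lemma right_exact_epi (C D : category) (P : abelian C) (Q : abelian D)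
    (F : functor C D) (x y : C) (a : mor x y) :
  is_right_exact P Q F -> is_epi a -> is_epi (fmap F a).
Proof.
by move=> [_ rexF] /(epi_short_exact P) [k [i /rexF []]].
Qed.

Section Coherence.
Variable BB : bicategory.

Lemma mul2_comp (A B C : BB) (f f' f'' : hom A B) (g g' g'' : hom B C)
    (α : mor f f') (α' : mor f' f'') (β : mor g g') (β' : mor g' g'') :
  (α' ∘ α) ⋆ (β' ∘ β) = (α' ⋆ β') ∘ (α ⋆ β).
Proof.
exact: (@fmap_comp _ _ (mult A B C) (f, g) (f', g') (f'', g'') (α', β') (α, β)).
Qed.

Lemma mul2_id (A B C : BB) (f : hom A B) (g : hom B C) :
  idm f ⋆ idm g = idm (f ⋅ g).
Proof. exact: (fmap_id (mult A B C) (f, g)). Qed.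

Lemma lwhisker_comp (A B C : BB) (h : hom A B) (f f' f'' : hom B C)
    (β : mor f' f'') (α : mor f f') :
  idm h ⋆ (β ∘ α) = (idm h ⋆ β) ∘ (idm h ⋆ α).
Proof. exact: (fmap_comp (left_mult C h)). Qed.

Lemma rwhisker_comp (A B C : BB) (h : hom B C) (f f' f'' : hom A B)
    (β : mor f' f'') (α : mor f f') :
  (β ∘ α) ⋆ idm h = (β ⋆ idm h) ∘ (α ⋆ idm h).
Proof. exact: (fmap_comp (right_mult A h)). Qed.

Lemma interchange (A B C : BB) (f f' : hom A B) (g g' : hom B C)
    (α : mor f f') (β : mor g g') :
  (idm f' ⋆ β) ∘ (α ⋆ idm g) = (α ⋆ idm g') ∘ (idm f ⋆ β).
Proof. by rewrite -!mul2_comp !comp_idl !comp_idr. Qed.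

(** Through [lunit], whiskering by the unit is naturally isomorphic to the identity functor, hence
    faithful. *)
Lemma lwhisker_unit_inj (A B : BB) (f f' : hom A B) (α β : mor f f') :
  idm (unit1 A) ⋆ α = idm (unit1 A) ⋆ β -> α = β.
Proof.
move=> e; apply: (iso_epi (lunit_iso f)).
by rewrite -!lunit_natural e.
Qed.

Lemma rwhisker_unit_inj (A B : BB) (f f' : hom A B) (α β : mor f f') :
  α ⋆ idm (unit1 B) = β ⋆ idm (unit1 B) -> α = β.
Proof.
move=> e; apply: (iso_epi (runit_iso f)).
by rewrite -!runit_natural e.
Qed.

(* Kelly's argument: whisker by the unit and use the pentagon for [I, I, f, g]. *)
Lemma lunit_mul (A B C : BB) (f : hom A B) (g : hom B C) :
  lunit (f ⋅ g) ∘ assoc (unit1 A) f g = lunit f ⋆ idm g.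
Proof.
set I := unit1 A; apply: lwhisker_unit_inj; rewrite lwhisker_comp.
apply: (iso_epi (assoc_iso I (I ⋅ f) g)).
apply: (iso_epi (fmap_iso (right_mult A g) (assoc_iso I I f))) => /=.
rewrite -assoc_natural -!comp_assoc -rwhisker_comp triangle assoc_natural.
rewrite mul2_id -triangle -comp_assoc pentagon.
by rewrite -!comp_assoc.
Qed.

(** Mirror image of [lunit_mul]: whisker by the unit on the right and use the pentagon for
    [f, g, I, I]. *)
Lemma runit_mul (A B C : BB) (f : hom A B) (g : hom B C) :
  (idm f ⋆ runit g) ∘ assoc f g (unit1 C) = runit (f ⋅ g).
Proof.
set I := unit1 C; apply: rwhisker_unit_inj; rewrite rwhisker_comp.
apply: (iso_mono (assoc_iso f g I)).
rewrite comp_assoc assoc_natural -(triangle g I) -(triangle (f ⋅ g) I).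
rewrite [RHS]comp_assoc -mul2_id assoc_natural -[RHS]comp_assoc pentagon.
by rewrite lwhisker_comp -!comp_assoc.
Qed.

(* Associativity turns this into [1_f ⋆ (first context axiom)] followed by
   [(second context axiom) ⋆ 1_g]; the triangle axiom passes [ρ] from one to
   the other. *)
Lemma Morita_slide (A B : BB) (Γ : wide_right_Morita_context A B) :
  runit (mc_f Γ ⋅ mc_g Γ) ∘ (idm (mc_f Γ ⋅ mc_g Γ) ⋆ mc_eta Γ)
  = lunit (mc_f Γ ⋅ mc_g Γ) ∘ (mc_eta Γ ⋆ idm (mc_f Γ ⋅ mc_g Γ)).
Proof.
case: Γ => f g η ρ /= compat_g compat_f.
apply: (iso_epi (assoc_iso (f ⋅ g) f g)).
(* The two sides meet here: the left one through the pentagon and both context axioms, the right one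
   through [lunit_mul] and naturality. *)
transitivity ((lunit f ∘ (η ⋆ idm f)) ⋆ idm g).
- rewrite -runit_mul -mul2_id -[X in X ∘ _ = _]comp_assoc assoc_natural.
  rewrite comp_assoc -lwhisker_comp -comp_assoc pentagon !comp_assoc.
  rewrite -lwhisker_comp compat_g compat_f lwhisker_comp !rwhisker_comp.
  by rewrite -triangle -!comp_assoc !(comp_assoc (assoc _ _ _)) assoc_natural
    -!comp_assoc.
- rewrite rwhisker_comp -lunit_mul -comp_assoc assoc_natural mul2_id.
  by rewrite comp_assoc.
Qed.

(** The context axioms are exchanged by this symmetry, so results on [η] carry over to [ρ]. *)
Definition swap_context (A B : BB) (Γ : wide_right_Morita_context A B) :
    wide_right_Morita_context B A :=
  WideRightMoritaContext (eq_sym (mc_compat_f Γ)) (eq_sym (mc_compat_g Γ)).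

Lemma Morita_eta_iso (ab : locally_abelian BB)
    (rex : right_exact_multiplications ab) (A B : BB)
    (Γ : wide_right_Morita_context A B) :
  is_epi (mc_eta Γ) -> is_iso (mc_eta Γ).
Proof.
move: (Morita_slide Γ); set fg := mc_f Γ ⋅ mc_g Γ; set η := mc_eta Γ.
move=> slide eη; apply: (mono_epi_iso (ab A A)) => //.
apply: (@mono_of_zero _ (ab A A)) => k u ηu.
have [rexl rexr] := rex.
have e1η : is_epi (idm k ⋆ η) := right_exact_epi (rexl A A A k) eη.
have right_zero := additive_zero k (unit1 A) (proj1 (rexr A A A fg)).
apply: (epi_comp (iso_epi (runit_iso k)) e1η).
(* Naturality of [runit] and interchange move [u] to the right of [η], where the slide brings
   [η ∘ u] together. *)
rewrite comp_zerol comp_assoc -runit_natural -comp_assoc -interchange.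
rewrite comp_assoc slide -comp_assoc -rwhisker_comp ηu.
by move: right_zero => /= ->; rewrite comp_zeror.
Qed.

End Coherence.

Theorem proposition1p2 (BB : bicategory) (ab : locally_abelian BB)
    (rex : right_exact_multiplications ab) (A B : BB)
    (Γ : wide_right_Morita_context A B) :
  (is_epi (mc_eta Γ) -> is_epi (mc_rho Γ) ->
     is_iso (mc_eta Γ) /\ is_iso (mc_rho Γ)) /\
  (is_epi (mc_eta Γ) -> is_epi (mc_rho Γ) -> equivalent A B).
Proof.
have isos : is_epi (mc_eta Γ) -> is_epi (mc_rho Γ) ->
    is_iso (mc_eta Γ) /\ is_iso (mc_rho Γ).
  move=> eη eρ; split; first exact: (Morita_eta_iso rex eη).
  exact: (Morita_eta_iso rex (Γ := swap_context Γ) eρ).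
split=> // eη eρ; have [iη [ψ [ψρ ρψ]]] := isos eη eρ.
(* An equivalence asks for a 2-cell out of the unit of [B], hence the inverse [ψ] of [ρ]. *)
by exists (mc_f Γ), (mc_g Γ), (mc_eta Γ), ψ; split=> //; exists (mc_rho Γ).
Qed.
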